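(* Let $p$ be an odd prime. Then \begin{align*} n(p^1,2)&=1+X_{2,3}(p),\\ n(p^2,2)&=3,\\ n(p^3,2)&=1+2X_{2,3}(p)+X_{2,5}(p),\\ n(p^4,2)&=4+X_{3,7}(p),\\ n(p^5,2)&=1+3X_{2,3}(p)+X_{3,5}(p)+X_{8,17}(p),\\ n(p^6,2)&=6+X_{15,31}(p),\\ n(p^7,2)&=1+X_{2,3}(p)\bigl(3+X_{7,11}(p)\bigr)+X_{2,5}(p)\bigl(1+X_{6,13}(p)\bigr)+X_{2,17}(p),\\ n(p^8,2)&=6+X_{5,7}(p)+X_{23,31}(p)+X_{63,127}(p). \end{align*}
   Context: $\mathbb{N}=\{0,1,2,\dots\}$. A numerical semigroup is a subset $S\subset\mathbb{N}$ containing $0$, stable under addition and with finite complement in $\mathbb{N}$; its genus is $|\mathbb{N}\setminus S|$. For $g\ge 1$, $n(g,2)$ denotes the number of numerical semigroups $S$ of genus $g$ of the form $S=\langle a,b\rangle=\mathbb{N}a+\mathbb{N}b$ (two generators); semigroups are counted as sets. For an integer $a$ and a prime $q$, the function $X_{a,q}:\mathbb{Z}\to\{0,1\}$ is defined by $X_{a,q}(n)=1$ if $n\not\equiv a \pmod q$ and $X_{a,q}(n)=0$ if $n\equiv a\pmod q$. *)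

(* Defs.v *)
From mathcomp Require Import all_boot all_order all_algebra finmap.
From mathcomp Require Import boolp classical_sets functions cardinality.

Set Implicit Arguments.
Unset Strict Implicit.
Unset Printing Implicit Defensive.

Local Open Scope classical_set_scope.
Local Open Scope nat_scope.

Definition numerical_semigroup (S : set nat) : Prop :=
  [/\ S 0,
      forall x y : nat, S x -> S y -> S (x + y)
    & finite_set (~` S)].

(* [fset_set A] is empty when [A] is infinite, so [genus] is meaningful only
   on sets with finite complement. *)
Definition genus (S : set nat) : nat := #|` fset_set (~` S)|.

Definition gen2 (a b : nat) : set nat :=
  [set n | exists x y : nat, n = x * a + y * b].

Definition semigroups2 (g : nat) : set (set nat) :=
  [set S | [/\ numerical_semigroup S, genus S = g
             & exists a b : nat, S = gen2 a b]].

(* n(g,2). For g >= 1 no such S is generated by a single element, since the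
   only cyclic numerical semigroup is nat itself, of genus 0. *)
Definition n2 (g : nat) : nat := #|` fset_set (semigroups2 g)|.

(* The {0,1}-valued X_{a,q}(n), through the coercion from bool to nat. *)
Definition X (a : int) (q : nat) (n : int) : nat := (n != a %[mod q])%Z.

(* Main.v *)
Require Import Defs.
From mathcomp Require Import all_boot all_order all_algebra.
From mathcomp Require Import finmap zify.
From mathcomp Require Import boolp classical_sets cardinality.

(** By Sylvester's theorem a numerical semigroup <a, b> has coprime generators
    and genus (a - 1)(b - 1) / 2 ([genus_gen2]). The proof used here rests on
    the symmetry of <a, b>: with F = ab - a - b, exactly one of n and F - n is
    in <a, b>, and everything beyond F is, so that exactly half of the integers
    from 0 to F are gaps.

    A semigroup of positive genus determines its generators: the smaller one
    is its least positive element and the genus then gives the other. Counting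
    semigroups of genus p ^ k is therefore counting the factorizations
    (a - 1)(b - 1) = 2 p ^ k with a and b coprime. As p is odd, exactly one of
    the two factors is odd, hence a power of p, so n(p ^ k, 2) is the number of
    i <= k for which p ^ i + 1 and 2 p ^ (k - i) + 1 are coprime
    ([n2_prime_power]).

    With j = k - i, a prime r dividing both numbers satisfies p ^ i = -1 and
    2 p ^ j = -1 modulo r. Computing (2 p ^ j) ^ i in two ways gives
    2 ^ i = (-1) ^ (i + j) modulo r, so that for i > 0 the prime r divides a
    nonzero integer independent of p ([dvdn_eliminant]). For each such r, having
    r as a common divisor depends only on p modulo r, and the finitely many bad
    residues are found by computation ([coprime_avoids]). For k = 1, ..., 8
    there is at most one bad residue for each i and r, which yields the
    functions X_{a,q} of the theorem. *)

(** * Semigroups with two generators *)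

Lemma gen2C a b : gen2 a b = gen2 b a.
Proof. by apply/seteqP; split=> n [x [y ->]]; exists y, x; rewrite addnC. Qed.

Lemma gen2_0 a b : gen2 a b 0.
Proof. by exists 0, 0. Qed.

Lemma gen2_add a b m n : gen2 a b m -> gen2 a b n -> gen2 a b (m + n).
Proof.
move=> [x [y ->]] [x' [y' ->]]; exists (x + x'), (y + y').
by rewrite !mulnDl addnACA.
Qed.

(** Modulo [a], every [n] is a multiple [y * b] with [y < a]; membership of [n]
    in <a, b> is then decided by comparing [n] with [y * b]. The second case
    uses [k.+1] so that the two cases exclude each other. *)
Lemma residue_rep a b n : 0 < a -> coprime a b ->
  exists y k, y < a /\ (n = k * a + y * b \/ y * b = n + k.+1 * a).
Proof.
move=> a_gt0 co_ab; have := chinese_modl co_ab n 0.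
have /dvdnP[q ->] : b %| chinese a b n 0.
  by rewrite /dvdn (chinese_modr co_ab) mod0n.
rewrite -modnMml => eq_mod; have := ltn_pmod q a_gt0.
move: (q %% a) eq_mod => y eq_mod lt_ya; exists y.
have [le_yn | lt_ny] := leqP (y * b) n.
  move/esym/eqP: eq_mod; rewrite eqn_mod_dvd // => /dvdnP[k def_k].
  by exists k; split=> //; left; rewrite -def_k subnK.
move/eqP: eq_mod; rewrite eqn_mod_dvd ?(ltnW lt_ny) // => /dvdnP[[|k] def_k].
  by rewrite mul0n in def_k; lia.
by exists k; split=> //; right; rewrite -def_k subnKC // ltnW.
Qed.

(** If [n] were less than its representative [y * b <= (a - 1) * b], it would
    be at most [(a - 1) * b - a], the Frobenius number. *)
Lemma gen2_ge_conductor a b n : 0 < a -> coprime a b ->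
  a.-1 * b.-1 <= n -> gen2 a b n.
Proof.
case: a => // a _ co_ab le_cn.
have [y [k [lt_ya [-> | eq_yb]]]] := residue_rep _ _ n (ltn0Sn a) co_ab.
  by exists k, y.
by case: b => [|b] in co_ab le_cn eq_yb *; rewrite /= in le_cn; nia.
Qed.

(** The hypothesis says that [m = F - n] for the Frobenius number
    [F = a * b - a - b]. Two members cannot add up to [F], since that would
    write [a * b] with two positive coefficients. Conversely, if
    [n = y * b - (k + 1) * a] is a gap then [F - n = (a - 1 - y) * b + k * a]. *)
Lemma gen2_symmetric a b m n : 0 < a -> coprime a b ->
  m + n + a + b = a * b -> gen2 a b m <-> ~ gen2 a b n.
Proof.
move=> a_gt0 co_ab eq_ab; split=> [[x [y def_m]] [x' [y' def_n]] | notSn].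
  have eq_comb : (x + x').+1 * a + (y + y').+1 * b = a * b by lia.
  have: a %| (y + y').+1 * b.
    by rewrite -(dvdn_addr _ (dvdn_mull (x + x').+1 (dvdnn a))) eq_comb dvdn_mulr.
  rewrite Gauss_dvdl // => /(dvdn_leq (ltn0Sn _)) le_a.
  by have := leq_mul le_a (leqnn b); nia.
have [y [k [lt_ya [def_n | def_n]]]] := residue_rep _ _ n a_gt0 co_ab.
  by case: notSn; exists k, y.
by exists k, (a.-1 - y); nia.
Qed.

Lemma gaps_gen2 a b : 0 < a -> coprime a b ->
  (~` gen2 a b)%classic
  = [set` [seq n <- iota 0 (a.-1 * b.-1) | ~~ `[< gen2 a b n >]]]%classic.
Proof.
move=> a_gt0 co_ab; apply/seteqP; split=> n /=; rewrite mem_filter mem_iota.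
  move=> notSn; rewrite (asboolF notSn) /= add0n ltnNge.
  by apply/negP=> /(gen2_ge_conductor _ _ _ a_gt0 co_ab).
by case/andP=> /asboolP.
Qed.

Lemma card_fset_set_uniq (T : choiceType) (s : seq T) :
  uniq s -> #|` fset_set [set` s]%classic| = size s.
Proof.
move=> s_uniq; rewrite -[RHS](congr1 size (undup_id s_uniq)) -card_fseq.
congr #|` _|; apply/fsetP=> x.
by rewrite in_fset_set ?inE //; apply/idP/idP; rewrite inE.
Qed.

Lemma genus_gen2_1 b : genus (gen2 1 b) = 0.
Proof.
rewrite /genus; suff -> : (~` gen2 1 b = set0)%classic by rewrite fset_set0 cardfs0.
by apply/seteqP; split=> n //=; case; exists n, 0; rewrite muln1 addn0.
Qed.

(** Sylvester's genus formula: the symmetry pairs the gaps below the conductor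
    [(a - 1) * (b - 1)] with the members below it. It also holds when a
    generator is 0, as the other one is then 1. *)
Lemma genus_gen2 a b : coprime a b -> 2 * genus (gen2 a b) = a.-1 * b.-1.
Proof.
have [->|a_gt0] := posnP a.
  by rewrite /coprime gcd0n => /eqP->; rewrite gen2C genus_gen2_1.
move=> co_ab; rewrite /genus gaps_gen2 //.
rewrite card_fset_set_uniq ?filter_uniq ?iota_uniq // size_filter.
set c := a.-1 * b.-1; rewrite -sum1_count mul2n -addnn.
have sum_gaps : \sum_(n <- iota 0 c | ~~ `[< gen2 a b n >]) 1
  = \sum_(n <- iota 0 c | `[< gen2 a b n >]) 1.
  have -> : iota 0 c = index_iota 0 c by rewrite /index_iota subn0.
  rewrite [RHS]big_nat_rev /= big_nat_cond [RHS]big_nat_cond.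
  apply: eq_bigl => n; apply: andb_id2l => /andP[_ lt_nc].
  rewrite add0n; apply/esym.
  rewrite -asbool_neg; apply/asbool_equiv_eq.
  by apply: gen2_symmetric => //; nia.
rewrite {1}sum_gaps; set P := fun n => `[< gen2 a b n >].
by have := count_predC P (iota 0 c); rewrite size_iota -!sum1_count.
Qed.

(** A cofinite set contains two consecutive integers, and the gcd of [a] and
    [b] divides both. *)
Lemma coprime_gen2 a b : finite_set (~` gen2 a b)%classic -> coprime a b.
Proof.
move=> /finite_seqP[s def_s].
pose n := (\max_(x <- s) x).+1.
have in_S m : n <= m -> gen2 a b m.
  move=> le_nm; apply: contrapT => notSm.
  have : [set` s]%classic m by rewrite -def_s.
  move=> /= m_s; have : m <= \max_(x <- s) x by exact: leq_bigmax_seq.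
  by move: le_nm; rewrite /n; lia.
have dvd_S m : gen2 a b m -> gcdn a b %| m.
  by case=> x [y ->]; rewrite dvdn_add ?dvdn_mull ?dvdn_gcdl ?dvdn_gcdr.
have := dvd_S _ (in_S n.+1 (leqnSn n)).
by rewrite -addn1 dvdn_addr ?dvdn1 //; exact: dvd_S (in_S n (leqnn n)).
Qed.

Lemma semigroups2P g S : 0 < g -> semigroups2 g S <->
  exists a b, [/\ coprime a b, a.-1 * b.-1 = 2 * g & S = gen2 a b].
Proof.
move=> g_gt0; split=> [[[_ _ fin_S] genus_S [a [b def_S]]] | [a [b [co_ab eq_g ->]]]].
  rewrite {S}def_S in fin_S genus_S *; have co_ab := coprime_gen2 _ _ fin_S.
  by exists a, b; split; rewrite // -genus_gen2 // genus_S.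
have a_gt0 : 0 < a by case: a eq_g {co_ab} => //=; lia.
split; [split | | by exists a, b].
- exact: gen2_0.
- by move=> x y; apply: gen2_add.
- by rewrite gaps_gen2 //; apply: finite_seq.
- by apply/eqP; rewrite -(eqn_pmul2l (ltn0Sn 1)) genus_gen2 // eq_g.
Qed.

Lemma gen2_min a b n : gen2 a b n -> 0 < n -> minn a b <= n.
Proof.
case=> x [y ->]; case: x => [|x]; first by case: y => // y _; rewrite geq_min; nia.
by rewrite geq_min; nia.
Qed.

Lemma gen2_minn a b : gen2 a b (minn a b).
Proof.
by case: (leqP a b) => _; [exists 1, 0 | exists 0, 1]; rewrite ?mul1n ?addn0.
Qed.

(** The least positive element gives the smaller generator, and the genus then
    gives the larger one. *)
Lemma gen2_inj a b a' b' : 1 < a -> 1 < b -> 1 < a' -> 1 < b' ->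
  coprime a b -> coprime a' b' ->
  gen2 a b = gen2 a' b' -> (a, b) = (a', b') \/ (a, b) = (b', a').
Proof.
move=> a_gt1 b_gt1 a'_gt1 b'_gt1 co co' eq_gen.
have eq_genus : a.-1 * b.-1 = a'.-1 * b'.-1.
  by rewrite -!genus_gen2 ?eq_gen //; lia.
have eq_min : minn a b = minn a' b'.
  apply/eqP; rewrite eqn_leq; apply/andP; split; apply: gen2_min.
  - by rewrite eq_gen; apply: gen2_minn.
  - lia.
  - by rewrite -eq_gen; apply: gen2_minn.
  - lia.
case: a b a' b' => [|[|a]] [|[|b]] [|[|a']] [|[|b']] //= in
  a_gt1 b_gt1 a'_gt1 b'_gt1 co co' eq_gen eq_genus eq_min *.
have [[eq1 eq2]|[eq1 eq2]] : (a = a' /\ b = b') \/ (a = b' /\ b = a').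
  by clear -eq_genus eq_min; nia.
- by left; rewrite eq1 eq2.
- by right; rewrite eq1 eq2.
Qed.

(** * Genus a power of an odd prime *)

Definition gens p k i := (p ^ i + 1, 2 * p ^ (k - i) + 1).

Definition exponents p k :=
  [seq i <- iota 0 k.+1 | coprime (gens p k i).1 (gens p k i).2].

(** Of the two factors [a - 1] and [b - 1] of [2 * p ^ k] one is odd, hence a
    power of [p]. *)
Lemma semigroups2_prime_power p k : prime p -> odd p ->
  semigroups2 (p ^ k) =
  [set gen2 (gens p k i).1 (gens p k i).2 | i in [set` exponents p k]]%classic.
Proof.
move=> p_prime p_odd; have p_gt0 := prime_gt0 p_prime.
apply/seteqP; split=> S; rewrite semigroups2P ?expn_gt0 ?p_gt0 //=.
  case=> a [b [co_ab eq_g ->]].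
  wlog odd_a : a b co_ab eq_g / odd a.-1.
    move=> base; have [|even_a] := boolP (odd a.-1); first exact: base.
    have [odd_b | even_b] := boolP (odd b.-1).
      by rewrite gen2C; apply: base; rewrite // ?(coprime_sym b) // mulnC.
    have /dvdnP[u def_u] : 2 %| a.-1 by rewrite dvdn2.
    have /dvdnP[v def_v] : 2 %| b.-1 by rewrite dvdn2.
    have : odd (p ^ k) by rewrite oddX p_odd orbT.
    have -> : p ^ k = 2 * (u * v) by lia.
    by rewrite oddM.
  have [i le_ik def_a] : exists2 i, i <= k & a.-1 = p ^ i.
    apply/(dvdn_pfactor _ _ p_prime).
    by rewrite -(@Gauss_dvdr _ 2) ?coprimen2 // -eq_g dvdn_mulr.
  have def_b : b.-1 = 2 * p ^ (k - i).
    apply/eqP; rewrite -(eqn_pmul2l (_ : 0 < p ^ i)) ?expn_gt0 ?p_gt0 //.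
    by rewrite -def_a eq_g def_a mulnCA -expnD subnKC.
  (* The powers of p are positive, so a and b are successors and the
     predecessors can be undone. *)
  have pi_gt0 : 0 < p ^ i by rewrite expn_gt0 p_gt0.
  have pj_gt0 : 0 < p ^ (k - i) by rewrite expn_gt0 p_gt0.
  have -> : a = (gens p k i).1 by rewrite /=; lia.
  have -> : b = (gens p k i).2 by rewrite /=; lia.
  exists i => //; rewrite /mkset mem_filter mem_iota /= add0n ltnS le_ik andbT.
  by rewrite -def_a -def_b; move: co_ab; congr coprime; lia.
case=> i; rewrite mem_filter mem_iota add0n ltnS => /and3P[co_i _ le_ik] <-.
exists (p ^ i + 1), (2 * p ^ (k - i) + 1); split=> //.
by rewrite !addn1 /= mulnCA -expnD subnKC.
Qed.

(** Distinct exponents give distinct semigroups: two generating pairs cannot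
    be exchanged, because [p ^ i] is odd and [2 * p ^ (k - i)] is even. *)
Lemma n2_prime_power p k : prime p -> odd p ->
  n2 (p ^ k) = size (exponents p k).
Proof.
move=> p_prime p_odd; have p_gt1 := prime_gt1 p_prime.
rewrite /n2 semigroups2_prime_power // fset_set_image; last exact: finite_seq.
rewrite card_in_imfset /=.
  by rewrite card_fset_set_uniq ?filter_uniq ?iota_uniq.
move=> i j; rewrite !(in_fset_set (finite_seq _)) => /set_mem /= i_s /set_mem /= j_s.
move: i_s j_s; rewrite !mem_filter => /andP[co_i _] /andP[co_j _].
have pow_gt0 e : 0 < p ^ e by rewrite expn_gt0 ltnW.
move/gen2_inj => -[] //=; rewrite ?addn1 ?ltnS ?muln_gt0 ?pow_gt0 //.
  by case=> /(expnI p_gt1).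
by case=> eq_ij _; have := congr1 odd eq_ij; rewrite oddM oddX p_odd orbT.
Qed.

(** * Common prime divisors *)

(** Reduction at each step keeps the unary numbers small enough to compute
    with. *)
Definition modexp r x n := iter n (fun y => y * x %% r) 1.

Lemma modexpE r x n : modexp r x n = x ^ n %[mod r].
Proof.
elim: n => //= n IHn; rewrite modn_mod expnSr -modnMml.
by rewrite /modexp in IHn; rewrite IHn modnMml.
Qed.

Definition common_root r i j x :=
  (r %| modexp r x i + 1) && (r %| 2 * modexp r x j + 1).

Lemma common_rootE r i j x :
  common_root r i j (x %% r) = (r %| x ^ i + 1) && (r %| 2 * x ^ j + 1).
Proof.
rewrite /common_root; congr (_ && _); rewrite /dvdn.
  by rewrite -modnDml modexpE modnXm modnDml.
by rewrite -modnDml -modnMmr modexpE modnXm modnMmr modnDml.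
Qed.

(** Up to sign, 2 ^ i - (-1) ^ (i + j). *)
Definition eliminant i j := if odd (i + j) then 2 ^ i + 1 else 2 ^ i - 1.

(** Modulo [r], the power p ^ (i * j) equals (-1) ^ j by the first divisibility,
    and its product with 2 ^ i equals (-1) ^ i by the second. *)
Lemma dvdn_eliminant p r i j : prime r ->
  r %| p ^ i + 1 -> r %| 2 * p ^ j + 1 -> r %| eliminant i j.
Proof.
move=> r_prime; have r_char := pchar_Fp r_prime.
rewrite !(GRing.Theory.dvdn_pcharf r_char).
rewrite (GRing.natrD _ (p ^ i)) (GRing.natrD _ (2 * p ^ j)) GRing.natrM !GRing.natrX.
move: (p%:R)%R => x; rewrite !GRing.addr_eq0 => /eqP xi /eqP xj.
have key : (2 ^+ i * (-1) ^+ j = (-1) ^+ i :> 'F_r)%R.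
  by rewrite -{1}xi -[in RHS]xj GRing.exprMn -!GRing.exprM mulnC.
have {}key : (2 ^+ i = (-1) ^+ (i + j) :> 'F_r)%R.
  rewrite GRing.exprD -key -GRing.mulrA -GRing.signr_odd -GRing.expr2.
  by rewrite GRing.sqrr_sign GRing.mulr1.
rewrite /eliminant; move: key; rewrite -GRing.signr_odd; case: odd => /= key.
  by rewrite GRing.natrD GRing.natrX key GRing.expr1 GRing.addNr.
by rewrite GRing.natrB ?expn_gt0 // GRing.natrX key GRing.expr0 GRing.subrr.
Qed.

(** A pair [(r, x)] stands for the bad residue class of [x] modulo [r]. *)
Definition obstructions i j :=
  [seq (r, x) | r <- primes (eliminant i j),
                x <- [seq x <- iota 0 r | common_root r i j x]].

Definition avoids p s := all (fun c : nat * nat => p %% c.1 != c.2) s.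

(** A failure of coprimality is witnessed by a prime [r], which divides the
    eliminant. The exponent [i = 0] has to be set apart since the eliminant can
    then vanish; but it would force [r = 2], while [2 * p ^ j + 1] is odd. *)
Lemma coprime_avoids p i j :
  coprime (p ^ i + 1) (2 * p ^ j + 1) = avoids p (obstructions i j).
Proof.
apply/idP/allP => [co [r x] /allpairsPdep[r' [x' [r_N]]] | avoid].
  rewrite mem_filter => /andP[root_x _] [-> ->] /=.
  apply: contraTneq co => def_x; move: root_x.
  rewrite -def_x common_rootE => /andP[dvd1 dvd2].
  have r_prime : prime r' by move: r_N; rewrite mem_primes => /and3P[].
  apply/negP=> /eqP co; have : r' %| 1 by rewrite -co dvdn_gcd dvd1.
  by rewrite dvdn1 => /eqP r1; rewrite r1 in r_prime.
apply/negPn/negP => not_co.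
pose r := pdiv (gcdn (p ^ i + 1) (2 * p ^ j + 1)).
have gcd_gt0 : 0 < gcdn (p ^ i + 1) (2 * p ^ j + 1) by rewrite gcdn_gt0 addn1.
have r_prime : prime r by apply: pdiv_prime; rewrite ltn_neqAle eq_sym not_co.
have /andP[dvd1 dvd2] : (r %| p ^ i + 1) && (r %| 2 * p ^ j + 1).
  by rewrite -dvdn_gcd pdiv_dvd.
have i_gt0 : 0 < i.
  rewrite lt0n; apply/eqP=> i0; move: dvd1; rewrite i0 expn0 dvdn_prime2 //.
  by move/eqP=> r2; move: dvd2; rewrite r2 dvdn2 oddD oddM.
have r_N : r \in primes (eliminant i j).
  rewrite mem_primes r_prime (dvdn_eliminant p) // andbT.
  rewrite /eliminant; case: ifP => _; first by rewrite addn1.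
  by rewrite subn_gt0 -[1](expn0 2) ltn_exp2l.
have := avoid (r, p %% r); rewrite eqxx => -/(_ _)/negP; case=> //.
apply/allpairsPdep; exists r, (p %% r); split=> //.
by rewrite mem_filter common_rootE dvd1 dvd2 mem_iota ltn_mod prime_gt0.
Qed.

Definition obstruction_table k := [seq obstructions i (k - i) | i <- iota 0 k.+1].

Lemma n2_obstructions p k : prime p -> odd p ->
  n2 (p ^ k) = sumn [seq nat_of_bool (avoids p s) | s <- obstruction_table k].
Proof.
move=> p_prime p_odd; rewrite n2_prime_power // size_filter -sumn_count -map_comp.
by congr sumn; apply: eq_map => i /=; rewrite coprime_avoids.
Qed.

Lemma X_nat (a q p : nat) : a < q -> X a q p = (p %% q != a).
Proof. by move=> lt_aq; rewrite /X !modz_nat (modn_small lt_aq). Qed.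

Lemma obstruction_table1 : obstruction_table 1 = [:: [::]; [:: (3, 2)]].
Proof. by vm_compute. Qed.

Lemma obstruction_table2 : obstruction_table 2 = [:: [::]; [::]; [::]].
Proof. by vm_compute. Qed.

Lemma obstruction_table3 : obstruction_table 3 =
  [:: [::]; [:: (3, 2)]; [:: (5, 2)]; [:: (3, 2)]].
Proof. by vm_compute. Qed.

Lemma obstruction_table4 : obstruction_table 4 =
  [:: [::]; [::]; [::]; [:: (7, 3)]; [::]].
Proof. by vm_compute. Qed.

Lemma obstruction_table5 : obstruction_table 5 =
  [:: [::]; [:: (3, 2)]; [:: (5, 3)]; [:: (3, 2)]; [:: (17, 8)]; [:: (3, 2)]].
Proof. by vm_compute. Qed.

Lemma obstruction_table6 : obstruction_table 6 =
  [:: [::]; [::]; [::]; [::]; [::]; [:: (31, 15)]; [::]].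
Proof. by vm_compute. Qed.

Lemma obstruction_table7 : obstruction_table 7 =
  [:: [::]; [:: (3, 2)]; [:: (5, 2)]; [:: (3, 2)]; [:: (17, 2)];
      [:: (3, 2); (11, 7)]; [:: (5, 2); (13, 6)]; [:: (3, 2)]].
Proof. by vm_compute. Qed.

Lemma obstruction_table8 : obstruction_table 8 =
  [:: [::]; [::]; [::]; [:: (7, 5)]; [::]; [:: (31, 23)]; [::];
      [:: (127, 63)]; [::]].
Proof. by vm_compute. Qed.

Theorem theorem7p1 (p : nat) (p_prime : prime p) (p_odd : odd p) :
  n2 (p ^ 1) = 1 + X 2 3 p /\
  n2 (p ^ 2) = 3 /\
  n2 (p ^ 3) = 1 + 2 * X 2 3 p + X 2 5 p /\
  n2 (p ^ 4) = 4 + X 3 7 p /\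
  n2 (p ^ 5) = 1 + 3 * X 2 3 p + X 3 5 p + X 8 17 p /\
  n2 (p ^ 6) = 6 + X 15 31 p /\
  n2 (p ^ 7) = 1 + X 2 3 p * (3 + X 7 11 p) + X 2 5 p * (1 + X 6 13 p)
               + X 2 17 p /\
  n2 (p ^ 8) = 6 + X 5 7 p + X 23 31 p + X 63 127 p.
Proof.
rewrite !n2_obstructions // obstruction_table1 obstruction_table2.
rewrite obstruction_table3 obstruction_table4 obstruction_table5.
rewrite obstruction_table6 obstruction_table7 obstruction_table8.
rewrite !X_nat // /avoids /=.
by do !split; do ![case: (_ != _)].
Qed.
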